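(* Let $F$ denote a demand distribution with support $S$ within $L$ and $H$, with $H$ large enough (e.g. $H=\infty$), that is strictly DGMRD and has finite second moment, and let $r^*$ denote the respective optimal wholesale price in the stochastic market. Additionally, suppose that $\alpha\in S$, with $\alpha>r^*$, is a realized demand level for which trading between supplier and retailers takes place in both the stochastic and the deterministic market. Let $\Pi^U_{\mathrm{Agg}}/\Pi^D_{\mathrm{Agg}}$ denote the ratio of the aggregate realized profits in the stochastic market to the aggregate profits in the deterministic market, with $n\ge1$ retailers. Then: (i) $\Pi^U_{\mathrm{Agg}}/\Pi^D_{\mathrm{Agg}}>1$ for $\alpha>2r^*$ if $n=1$ or $n=2$, and for $\alpha\in\left(2r^*,\frac{2n}{n-2}r^*\right)$ if $n\ge3$. (ii) $\Pi^U_{\mathrm{Agg}}/\Pi^D_{\mathrm{Agg}}$ is maximized for $\alpha^*=2nr^*/(n-1)$ for $n\ge2$, for which it is equal to $1+(n(n+2))^{-1}$. Moreover, $\Pi^U_{\mathrm{Agg}}/\Pi^D_{\mathrm{Agg}}$ converges to $4/(n+2)$ as $\alpha\to\infty$ for any $n\ge1$. (iii) $\Pi^U_{\mathrm{Agg}}/\Pi^D_{\mathrm{Agg}}$ increases in the level $n$ of competition for demand levels $\alpha<2r^*$ and decreases thereafter (i.e. for $\alpha>2r^*$).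
   Context: Setting: a supplier sells to $n\ge1$ symmetric retailers engaged in classic Cournot competition with linear demand (slope scaled to 1). Given a wholesale price $r\ge0$ and realized demand level $\alpha$, each retailer orders $q_i^*(r)=\frac{1}{n+1}(\alpha-r)_+$ in equilibrium, where $(x)_+=\max\{0,x\}$. In the stochastic market (superscript $U$) the supplier only knows the demand distribution $F$; in the deterministic market (superscript $D$) the supplier knows $\alpha$ and charges $\alpha/2$. The demand is nonnegative with continuous (non-atomic) cdf $F$, $F(0)=0$, and finite mean; $\bar F:=1-F$, $S$ is the support of $F$, $L=\sup\{r\ge0:F(r)=0\}$, $H=\inf\{r\ge0:F(r)=1\}\in(0,\infty]$. The mean residual demand function is $\mathrm{m}(r):=\frac{1}{\bar F(r)}\int_r^\infty\bar F(u)\,du$ for $r<H$, $\mathrm{m}(r):=0$ otherwise. $F$ is strictly DGMRD if $\mathrm{m}(r)/r$ is strictly decreasing on $(0,H)$. If $F$ is strictly DGMRD with finite second moment, the supplier's optimal price in the stochastic market, i.e. the maximizer $r^*$ over $r\ge0$ of $r\int_r^\infty\bar F(u)\,du$, exists and is the unique solution of $r=\mathrm{m}(r)$. Realized equilibrium profits at demand level $\alpha$ are: stochastic market: $\Pi_s^U=\frac{n}{n+1}r^*(\alpha-r^* )_+$ (supplier), $\Pi_i^U=\frac{1}{(n+1)^2}(\alpha-r^* )_+^2$ (retailer $i$), $\Pi^U_{\mathrm{Agg}}=\Pi_s^U+\sum_{i=1}^n\Pi_i^U$ (aggregate); deterministic market: $\Pi_s^D=\frac{n}{n+1}(\alpha/2)^2$,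 $\Pi_i^D=\frac{1}{(n+1)^2}(\alpha/2)^2$, $\Pi^D_{\mathrm{Agg}}=\Pi_s^D+\sum_{i=1}^n\Pi_i^D$. The ratio $\Pi^U_{\mathrm{Agg}}/\Pi^D_{\mathrm{Agg}}$ is regarded as a function of $\alpha>r^*$ (and of $n$) through these formulas; ''$H$ large enough'' is a technical assumption ensuring that the demand levels mentioned are in the admissible range. *)

(* Defs.v *)
From HB Require Import structures.
From mathcomp Require Import all_boot all_order all_algebra.
From mathcomp Require Import all_classical all_reals all_analysis.

Set Implicit Arguments.
Unset Strict Implicit.
Unset Printing Implicit Defensive.

Import Order.TTheory GRing.Theory Num.Theory.
Import numFieldNormedType.Exports.

Local Open Scope classical_set_scope.
Local Open Scope ring_scope.

Section demand.
Context (d : measure_display) (T : measurableType d) (R : realType).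
Context (P : probability T R) (X : {RV P >-> R}).

(* Continuity of the cdf says that the law of X has no atoms. *)
Definition is_demand : Prop :=
  [/\ {ae P, forall w, 0 <= X w},
      continuous (cdf X),
      cdf X 0 = 0%E
    & (X : T -> R) \in Lfun P 1%:E].

Definition finite_second_moment : Prop := (X : T -> R) \in Lfun P 2%:E.

(* H = inf {r >= 0 : F(r) = 1}, equal to +oo when F never reaches 1. *)
Definition demand_sup : \bar R :=
  ereal_inf [set r%:E | r in [set r : R | 0 <= r /\ cdf X r = 1%E]].

Definition ccdf_tail (r : R) : \bar R :=
  (\int[lebesgue_measure]_(u in `[r, +oo[) ccdf X u)%E.

Definition mean_residual_demand (r : R) : R :=
  if (r%:E < demand_sup)%E then fine (ccdf_tail r) / fine (ccdf X r) else 0.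

Definition strictly_DGMRD : Prop :=
  forall r s : R, 0 < r -> r < s -> (s%:E < demand_sup)%E ->
    mean_residual_demand s / s < mean_residual_demand r / r.

Definition optimal_price (rs : R) : Prop :=
  0 <= rs /\
  forall r : R, 0 <= r -> (r%:E * ccdf_tail r <= rs%:E * ccdf_tail rs)%E.

End demand.

(* Realized profits with n retailers at demand level alpha: suffix U for the
   stochastic market with wholesale price rs, D for the deterministic one. *)
Section profits.
Context {R : realType}.

Definition pos_part (x : R) : R := Num.max 0 x.

Definition supplierU (rs : R) (n : nat) (alpha : R) : R :=
  n%:R / n.+1%:R * rs * pos_part (alpha - rs).

Definition retailerU (rs : R) (n : nat) (alpha : R) : R :=
  (n.+1%:R ^+ 2)^-1 * pos_part (alpha - rs) ^+ 2.

Definition aggregateU (rs : R) (n : nat) (alpha : R) : R :=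
  supplierU rs n alpha + \sum_(i < n) retailerU rs n alpha.

Definition supplierD (n : nat) (alpha : R) : R :=
  n%:R / n.+1%:R * (alpha / 2) ^+ 2.

Definition retailerD (n : nat) (alpha : R) : R :=
  (n.+1%:R ^+ 2)^-1 * (alpha / 2) ^+ 2.

Definition aggregateD (n : nat) (alpha : R) : R :=
  supplierD n alpha + \sum_(i < n) retailerD n alpha.

Definition aggregate_ratio (rs : R) (n : nat) (alpha : R) : R :=
  aggregateU rs n alpha / aggregateD n alpha.

End profits.

(* Main.v *)
(* Writing t = rs / alpha, the ratio of aggregate profits equals
   4 (1 - t) (1 + n t) / (n + 2).  It is a concave quadratic in t that vanishes
   at t = 1 and is maximal at t = (n - 1) / (2 n); it tends to 4 / (n + 2) as
   t -> 0, and (1 + n t) / (n + 2) increases in n exactly when t > 1 / 2.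
   The optimal price enters only through rs > 0: since the cdf is continuous
   and vanishes at 0, some small positive price earns a positive profit,
   whereas the price 0 earns none. *)
Require Import Defs.
From HB Require Import structures.
From mathcomp Require Import all_boot all_order all_algebra.
From mathcomp Require Import all_classical all_reals all_analysis.
From mathcomp Require Import measurable_realfun ring lra.
Import Order.TTheory GRing.Theory Num.Theory.
Import numFieldNormedType.Exports.
Local Open Scope classical_set_scope.
Local Open Scope ring_scope.

Section optimal_price.
Context (d : measure_display) (T : measurableType d) (R : realType).
Context (P : probability T R) (X : {RV P >-> R}).

(** Since [ccdf X] is nonincreasing, the tail integral is at least [(s - r) * ccdf X s]. *)
Lemma ccdf_tail_gt0 (r s : R) : r < s -> (0 < ccdf X s)%E ->
  (0 < ccdf_tail X r)%E.
Proof.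
move=> rs Xs.
apply: (@lt_le_trans _ _ (\int[lebesgue_measure]_(u in `[r, s]) ccdf X s)%E).
  rewrite integral_cst//= lebesgue_measure_itv/= lte_fin rs.
  by rewrite mule_gt0// -EFinB lte_fin subr_gt0.
apply: (@le_trans _ _ (\int[lebesgue_measure]_(u in `[r, s]) ccdf X u)%E).
  apply: ge0_le_integral => //=.
  exact: measurable_funTS (ccdf_measurable X).
  move=> u; rewrite in_itv/= => /andP[_ us].
  exact: ccdf_nonincreasing.
apply: ge0_subset_integral => //=.
  exact: measurable_funTS (ccdf_measurable X).
by apply: subset_itvl; rewrite bnd_simp.
Qed.

Lemma optimal_price_gt0 (rs : R) : is_demand X -> optimal_price X rs -> 0 < rs.
Proof.
move=> [_ cX X0 _] [rs0 max_rs]; rewrite lt_neqAle rs0 andbT.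
apply/eqP => rsE; rewrite -{}rsE mul0e in max_rs.
have : \forall s \near 0, (cdf X s < 1)%E.
  have lt1 : nbhs (cdf X 0) [set y | (y < 1)%E].
    rewrite X0; apply: open_nbhs_nbhs; split; first exact: open_ereal_lt_ereal.
    by rewrite /= lte01.
  exact: (cX 0 _ lt1).
move=> [e /= e0 Xe].
(* The cdf is below 1 within distance [e] of 0. The point [e / 2] lies strictly inside that ball,
   and the profitable price [e / 4] lies below it, as [ccdf_tail_gt0] requires. *)
have e20 : 0 < e / 2 by rewrite divr_gt0.
have Xe2 : (0 < ccdf X (e / 2))%E.
  rewrite ccdf_1_cdf sube_gt0; apply: Xe => /=.
  by rewrite sub0r normrN gtr0_norm// gtr_pMr// invf_lt1// ltr1n.
have e40 : 0 < e / 4 by rewrite divr_gt0.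
have := max_rs _ (ltW e40); apply/negP; rewrite -ltNge.
by rewrite mule_gt0// (@ccdf_tail_gt0 _ (e / 2))//; lra.
Qed.

End optimal_price.

Section ratio.
Context {R : realType}.
Implicit Types (rs a : R) (n : nat).

Lemma aggregate_ratioE rs n a : (0 < n)%N -> 0 <= rs -> rs < a ->
  aggregate_ratio rs n a =
  4 * (1 - rs / a) * (1 + n%:R * (rs / a)) / (n%:R + 2).
Proof.
move=> n0 rs0 rsa.
have nR : 0 < n%:R :> R by rewrite ltr0n.
rewrite /aggregate_ratio /aggregateU /aggregateD /supplierU /supplierD.
rewrite /retailerU /retailerD /pos_part !sumr_const !card_ord.
rewrite -![(_^-1 * _) *+ n]mulr_natl.
rewrite (max_idPr _); last by lra.
rewrite -natr1.
have ? : a != 0 by lra.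
have ? : n%:R + 1 != 0 :> R by lra.
have ? : n%:R + 2 != 0 :> R by lra.
field.
(* This side condition is the numerator of [aggregateD]; factored, it is visibly nonzero. *)
rewrite (_ : n%:R * a ^+ 2 * _ + _ = n%:R * a ^+ 2 * (n%:R + 2)); last by ring.
by rewrite !mulf_neq0 ?expf_neq0 ?gt_eqF//; repeat (apply/andP; split); lra.
Qed.

(** The excess over 1 factors with zeros at [a = 2 rs] and [(n - 2) a = 2 n rs]. The second bound is
    kept free of division so that [n <= 2] is covered too. *)
Lemma aggregate_ratio_gt1 rs n a : (0 < n)%N -> 0 <= rs -> 2 * rs < a ->
  (n%:R - 2) * a < 2 * n%:R * rs -> 1 < aggregate_ratio rs n a.
Proof.
move=> n0 rs0 rsa na.
have nR : 0 < n%:R :> R by rewrite ltr0n.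
rewrite aggregate_ratioE//; last by lra.
rewrite ltr_pdivlMr ?mul1r; last by lra.
have a0 : 0 < a by lra.
rewrite -subr_gt0.
have -> : 4 * (1 - rs / a) * (1 + n%:R * (rs / a)) - (n%:R + 2) =
  (a - 2 * rs) * (2 * n%:R * rs - (n%:R - 2) * a) / a ^+ 2.
  by field; lra.
by rewrite divr_gt0 ?exprn_gt0// mulr_gt0 ?subr_gt0.
Qed.

Lemma aggregate_ratio_argmax rs n : (2 <= n)%N -> 0 < rs ->
  aggregate_ratio rs n (2 * n%:R * rs / (n%:R - 1)) =
  1 + (n%:R * (n%:R + 2))^-1.
Proof.
move=> n2 rs0.
have nR : 2 <= n%:R :> R by rewrite ler_nat.
rewrite aggregate_ratioE ?(ltnW n2) ?(ltW rs0)//; last first.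
  by rewrite ltr_pdivlMr; nra.
by field; repeat (apply/andP; split); lra.
Qed.

(** Completing the square in [t = rs / a]: the gap is a multiple of [(2 n t - (n - 1))^2]. *)
Lemma aggregate_ratio_le_max rs n a : (0 < n)%N -> 0 <= rs -> rs < a ->
  aggregate_ratio rs n a <= 1 + (n%:R * (n%:R + 2))^-1.
Proof.
move=> n0 rs0 rsa.
have nR : 0 < n%:R :> R by rewrite ltr0n.
rewrite aggregate_ratioE//; set t := rs / a; rewrite -subr_ge0.
have -> : 1 + (n%:R * (n%:R + 2))^-1 -
    4 * (1 - t) * (1 + n%:R * t) / (n%:R + 2) =
    (2 * n%:R * t - (n%:R - 1)) ^+ 2 / (n%:R * (n%:R + 2)).
  by field; repeat (apply/andP; split); lra.
by rewrite divr_ge0 ?sqr_ge0//; nra.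
Qed.

(** The cross difference [(1 + n t)(m + 2) - (1 + m t)(n + 2)] equals [(n - m)(2 t - 1)]. Isolating
    the sign factor [2 rs - a] serves both directions of monotonicity. *)
Lemma aggregate_ratio_sub rs m n a : (0 < m)%N -> (m < n)%N ->
  0 <= rs -> rs < a ->
  exists2 c, 0 < c &
    aggregate_ratio rs n a - aggregate_ratio rs m a = c * (2 * rs - a).
Proof.
move=> m0 mn rs0 rsa.
have mR : 0 < m%:R :> R by rewrite ltr0n.
have nR : m%:R < n%:R :> R by rewrite ltr_nat.
exists (4 * (1 - rs / a) * (n%:R - m%:R) / ((m%:R + 2) * (n%:R + 2)) / a).
  have ? : rs / a < 1 by rewrite ltr_pdivrMr ?mul1r//; lra.
  by rewrite !divr_gt0 ?mulr_gt0//; lra.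
rewrite !aggregate_ratioE// ?(ltn_trans m0)//.
by field; repeat (apply/andP; split); lra.
Qed.

Lemma cvg_aggregate_ratio rs n : (0 < n)%N -> 0 <= rs ->
  aggregate_ratio rs n a @[a --> +oo] --> (4 / (n%:R + 2) : R).
Proof.
move=> n0 rs0.
have cvt : rs / a @[a --> +oo] --> (0 : R).
  rewrite -[X in _ --> X](mulr0 rs); apply: cvgM; first exact: cvg_cst.
  by apply/gtr0_cvgV0; [exact: nbhs_pinfty_gt|exact: cvg_id].
apply: (@cvg_trans _ ((fun a => 4 * (1 - rs / a) * (1 + n%:R * (rs / a)) /
    (n%:R + 2)) @ +oo)).
  apply: near_eq_cvg; near=> a.
  rewrite aggregate_ratioE//.
  by near: a; apply: nbhs_pinfty_gt; exact: num_real.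
have -> : 4 / (n%:R + 2) = 4 * (1 - 0) * (1 + n%:R * 0) / (n%:R + 2) :> R.
  by rewrite subr0 mulr0 addr0 !mulr1.
apply: cvgM; last exact: cvg_cst.
apply: cvgM.
  apply: cvgM; first exact: cvg_cst.
  by apply: cvgB => //; exact: cvg_cst.
apply: cvgD; first exact: cvg_cst.
by apply: cvgM => //; exact: cvg_cst.
Unshelve. all: by end_near.
Qed.

End ratio.

(* The ratio is treated as a function of every alpha > rs, so demand levels in
   the support of the law of X are included and no bound on the essential
   supremum H of the demand has to be imposed. *)
Theorem theorem5p6 (R : realType) (d : measure_display) (T : measurableType d)
    (P : probability T R) (X : {RV P >-> R}) (rs : R)
    (hX : is_demand X)
    (hdgmrd : strictly_DGMRD X)
    (hmoment : finite_second_moment X)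
    (hrs : optimal_price X rs) :
  (* (i) *)
  (forall (n : nat) (alpha : R), n = 1%N \/ n = 2%N ->
     rs < alpha -> 2 * rs < alpha -> 1 < aggregate_ratio rs n alpha) /\
  (forall (n : nat) (alpha : R), (3 <= n)%N ->
     rs < alpha -> 2 * rs < alpha -> alpha < 2 * n%:R / (n%:R - 2) * rs ->
     1 < aggregate_ratio rs n alpha) /\
  (* (ii) *)
  (forall n : nat, (2 <= n)%N ->
     let alpha_star : R := 2 * n%:R * rs / (n%:R - 1) in
     [/\ rs < alpha_star,
         forall alpha : R, rs < alpha ->
           aggregate_ratio rs n alpha <= aggregate_ratio rs n alpha_star
       & aggregate_ratio rs n alpha_star = 1 + (n%:R * (n%:R + 2))^-1]) /\
  (forall n : nat, (1 <= n)%N ->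
     aggregate_ratio rs n alpha @[alpha --> +oo] --> (4 / (n%:R + 2) : R)) /\
  (* (iii) *)
  (forall (alpha : R) (m n : nat), (1 <= m)%N -> (m < n)%N ->
     rs < alpha -> alpha < 2 * rs ->
     aggregate_ratio rs m alpha < aggregate_ratio rs n alpha) /\
  (forall (alpha : R) (m n : nat), (1 <= m)%N -> (m < n)%N ->
     rs < alpha -> 2 * rs < alpha ->
     aggregate_ratio rs n alpha < aggregate_ratio rs m alpha).
Proof.
have rs0 := optimal_price_gt0 _ _ _ _ _ _ hX hrs.
have rsge0 := ltW rs0.
split=> [n a n12 _ rsa|].
  (* For [n = 2] the remaining bound reads [0 < 4 rs], so strict positivity of [rs] matters. *)
  by apply: aggregate_ratio_gt1 => //; case: n12 => -> //; nra.
split=> [n a n3 _ rsa|].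
  have nR : 3 <= n%:R :> R by rewrite ler_nat.
  rewrite mulrAC ltr_pdivlMr 1?mulrC; last by lra.
  by move=> na; apply: aggregate_ratio_gt1 => //; exact: leq_trans n3.
split=> [n n2 /=|].
  rewrite aggregate_ratio_argmax//; split=> //.
    have nR : 2 <= n%:R :> R by rewrite ler_nat.
    by rewrite ltr_pdivlMr; nra.
  by move=> a rsa; apply: aggregate_ratio_le_max => //; exact: ltnW.
split=> [n n1|]; first exact: cvg_aggregate_ratio.
split=> a m n m1 mn rsa a2;
    have [c c0 E] := aggregate_ratio_sub _ _ _ _ m1 mn rsge0 rsa.
  by rewrite -subr_gt0 E mulr_gt0// subr_gt0.
by rewrite -subr_lt0 E pmulr_rlt0// subr_lt0.
Qed.
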